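(* Let $\mathfrak G,\tilde{\mathfrak G}<\mathrm{Aut}(\mathcal T_2)$ and $\Gamma,K,\overline\Gamma,\overline K,\overline{\overline\Gamma}<\mathrm{Aut}(\mathcal T_3)$ be the groups defined in the context. Then: (a) $\Gamma$ has a torsion-free subgroup of index $3$, and $\overline\Gamma$ has a torsion-free subgroup of index $3$; (b) $K$ and $\overline K$ are torsion-free; (c) none of the groups $\mathfrak G$, $\tilde{\mathfrak G}$, $\overline{\overline\Gamma}$ has a torsion-free subgroup of finite index.
   Context: For $\Sigma=\{1,\dots,d\}$, $\mathcal T_d=\Sigma^*$ is the rooted tree whose vertices are the finite words over $\Sigma$, the children of $\sigma$ being the words $\sigma s$, $s\in\Sigma$. For $h\in\mathrm{Aut}(\mathcal T_d)$ fixing all words of length $1$, write $\psi(h)=(h_1,\dots,h_d)$ if $h(i\tau)=i\,h_i(\tau)$ for all $i\in\Sigma$, $\tau\in\Sigma^*$. Groups on $\mathcal T_2$: let $a$ be the automorphism exchanging the two branches at the root ($a(1\tau)=2\tau$, $a(2\tau)=1\tau$). Define recursively $b,c,d$ by $\psi(b)=(a,c)$, $\psi(c)=(a,d)$, $\psi(d)=(1,b)$, and $\mathfrak G=\langle a,b,c,d\rangle$. Define recursively $\tilde b,\tilde c,\tilde d$ by $\psi(\tilde b)=(a,\tilde c)$, $\psi(\tilde c)=(1,\tilde d)$, $\psi(\tilde d)=(1,\tilde b)$, and $\tilde{\mathfrak G}=\langle a,\tilde b,\tilde c,\tilde d\rangle$. Groups on $\mathcal T_3$: let $a$ be the automorphism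 cyclically permuting the three branches at the root ($1\tau\mapsto2\tau\mapsto3\tau\mapsto1\tau$). Define recursively $r,s,t$ by $\psi(r)=(a,1,r)$, $\psi(s)=(a,a,s)$, $\psi(t)=(a,a^{-1},t)$, and $\Gamma=\langle a,r\rangle$, $\overline\Gamma=\langle a,s\rangle$, $\overline{\overline\Gamma}=\langle a,t\rangle$. In these formulas $1$ as a component denotes the identity automorphism. $K$ is the normal subgroup $\langle ar,ra\rangle$ of $\Gamma$, and $\overline K$ is the normal subgroup $\langle sa^{-1},a^{-1}s\rangle$ of $\overline\Gamma$. *)

(* Defs.v *)
From HB Require Import structures.
From mathcomp Require Import all_boot.
From mathcomp Require Import all_classical.

Set Implicit Arguments.
Unset Strict Implicit.
Unset Printing Implicit Defensive.

Local Open Scope classical_set_scope.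
Local Open Scope group_scope.

(* The regular rooted tree: its vertices are the words over 'I_d.  Letters are
   numbered from 0: the letter i of Sigma = {1, ..., d} is the ordinal i - 1. *)

Definition vertex (d : nat) := seq 'I_d.

Definition child d (u v : vertex d) : Prop := exists s : 'I_d, v = rcons u s.

(* The relation child determines the root (the only vertex which is nobody's
   child), so that it need not be required that automorphisms fix it. *)
Record treeAut (d : nat) := TreeAut {
  taut_fun :> vertex d -> vertex d;
  taut_bij : bijective taut_fun;
  taut_child : forall u v, child (taut_fun u) (taut_fun v) <-> child u v
}.

Lemma treeAut_ext d (f g : treeAut d) : f =1 g -> f = g.
Proof.
case: f g => [f fb fc] [g gb gc] /= /funext fg; subst g.
by congr TreeAut; exact: Prop_irrelevance.
Qed.

HB.instance Definition _ d := gen_eqMixin (treeAut d).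
HB.instance Definition _ d := gen_choiceMixin (treeAut d).

Section Group.
Variable d : nat.
Implicit Types f g : treeAut d.

Lemma inv_subproof f : exists g : treeAut d, cancel f g /\ cancel g f.
Proof.
have [g fK gK] := taut_bij f.
have gb : bijective g by exists f.
have gc u v : child (g u) (g v) <-> child u v.
  by rewrite -(taut_child f) !gK.
by exists (TreeAut gb gc).
Qed.

Definition taut_inv f : treeAut d := projT1 (cid (inv_subproof f)).

Lemma taut_invK f : cancel f (taut_inv f).
Proof. by rewrite /taut_inv; case: cid => g []. Qed.

Lemma taut_Kinv f : cancel (taut_inv f) f.
Proof. by rewrite /taut_inv; case: cid => g []. Qed.

Lemma one_child (u v : vertex d) : child (id u) (id v) <-> child u v.
Proof. by []. Qed.

Definition taut_one : treeAut d := TreeAut (inv_bij (fun=> erefl)) one_child.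

Lemma mul_child f g u v : child ((f \o g) u) ((f \o g) v) <-> child u v.
Proof. by rewrite /= !taut_child. Qed.

Definition taut_mul f g : treeAut d :=
  TreeAut (bij_comp (taut_bij f) (taut_bij g)) (mul_child f g).

Lemma taut_mulA : associative taut_mul.
Proof. by move=> f g h; apply: treeAut_ext. Qed.

Lemma taut_mul1g : left_id taut_one taut_mul.
Proof. by move=> f; apply: treeAut_ext. Qed.

Lemma taut_mulg1 : right_id taut_one taut_mul.
Proof. by move=> f; apply: treeAut_ext. Qed.

Lemma taut_mulVg : left_inverse taut_one taut_inv taut_mul.
Proof. by move=> f; apply: treeAut_ext => w /=; rewrite taut_invK. Qed.

Lemma taut_mulgV : right_inverse taut_one taut_inv taut_mul.
Proof. by move=> f; apply: treeAut_ext => w /=; rewrite taut_Kinv. Qed.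

End Group.

(* Automorphisms act on the left: (f * g) w = f (g w). *)
HB.instance Definition _ d := isGroup.Build (treeAut d)
  (@taut_mulA d) (@taut_mul1g d) (@taut_mulg1 d) (@taut_mulVg d)
  (@taut_mulgV d).

Lemma mul_tautE d (f g : treeAut d) w : (f * g) w = f (g w).
Proof. by []. Qed.

Lemma one_tautE d (w : vertex d) : (1 : treeAut d) w = w.
Proof. by []. Qed.

Lemma taut_nil d (f : treeAut d) : f [::] = [::].
Proof.
have [g _ gK] := taut_bij f; have := gK [::].
case/lastP: (g [::]) => [//|u s] fus.
have : child (f u) (f (rcons u s)) by apply/taut_child; exists s.
by rewrite fus => -[s']; case: (f u).
Qed.

Lemma child_of_rcons d (f : vertex d -> vertex d) :
    bijective f -> f [::] = [::] ->
    (forall u s, exists s', f (rcons u s) = rcons (f u) s') ->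
  forall u v, child (f u) (f v) <-> child u v.
Proof.
move=> fb f0 fr u v; split; last by case=> s ->; exact: fr.
case/lastP: v => [|v s].
  by rewrite f0 => -[s]; case: (f u).
have [s' ->] := fr v s => -[s''] /rcons_inj[/(bij_inj fb) -> _].
by exists s.
Qed.

Lemma taut_rcons d (f : treeAut d) u s :
  exists s', f (rcons u s) = rcons (f u) s'.
Proof. by apply/taut_child; exists s. Qed.

(* is_psi h [tuple h_1; ...; h_d] says that h fixes all words of length 1 and
   psi(h) = (h_1, ..., h_d). *)
Definition is_psi d (h : treeAut d) (hs : d.-tuple (treeAut d)) : Prop :=
  forall (i : 'I_d) (tau : vertex d), h (i :: tau) = i :: tnth hs i tau.

(* The cyclic permutation of the branches at the root,
   1 tau |-> 2 tau |-> ... |-> d tau |-> 1 tau; for d = 2 it exchanges the two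
   branches. *)
Section RootCycle.
Variable d : nat.

Definition root_cycle_fun (w : vertex d) : vertex d :=
  if w is i :: tau then ordS i :: tau else [::].

Lemma root_cycle_bij : bijective root_cycle_fun.
Proof.
by exists (fun w => if w is i :: tau then ord_pred i :: tau else [::]);
  case=> //= i tau; rewrite ?ordSK ?ord_predK.
Qed.

Lemma root_cycle_child u v :
  child (root_cycle_fun u) (root_cycle_fun v) <-> child u v.
Proof.
apply: (child_of_rcons root_cycle_bij erefl) => -[|i u'] s.
- by exists (ordS s).
- by exists s.
Qed.

Definition root_cycle : treeAut d := TreeAut root_cycle_bij root_cycle_child.

End RootCycle.

(* Automorphisms (h_s)_s defined by simultaneous recursion: the system sys gives
   the components of psi(h_s), each one being either a known automorphism
   (inl g) or one of the automorphisms being defined (inr s', standing for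
   h_s').  See recAut_psi and recAut_uniq. *)
Section Recursion.
Variables (d : nat) (S : Type) (sys : S -> d.-tuple (treeAut d + S)).

Fixpoint rec_fun (sy : S -> d.-tuple (treeAut d + S)) (s : S) (w : vertex d)
    : vertex d :=
  if w is i :: tau then
    i :: match tnth (sy s) i with
         | inl g => g tau
         | inr s' => rec_fun sy s' tau
         end
  else [::].

Let inv_sys (s : S) : d.-tuple (treeAut d + S) :=
  map_tuple (fun x => match x with inl g => inl g^-1 | inr s' => inr s' end)
    (sys s).

Lemma rec_fun_bij s : bijective (rec_fun sys s).
Proof.
exists (rec_fun inv_sys s) => w; elim: w s => //= i w IH s.
- by rewrite tnth_map; case: (tnth _ _) => [g|s']; rewrite ?IH // taut_invK.
- by rewrite tnth_map; case: (tnth _ _) => [g|s']; rewrite ?IH // taut_Kinv.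
Qed.

Lemma rec_fun_child s u v :
  child (rec_fun sys s u) (rec_fun sys s v) <-> child u v.
Proof.
apply: (child_of_rcons (rec_fun_bij s) erefl) => {}u {}v; elim: u s => [|i u IH] s /=.
  by exists v; case: (tnth _ _) => [g|//]; rewrite taut_nil.
case: (tnth _ _) => [g|s'].
  by have [v' ->] := taut_rcons g u v; exists v'.
by have [v' ->] := IH s'; exists v'.
Qed.

Definition recAut (s : S) : treeAut d :=
  TreeAut (rec_fun_bij s) (rec_fun_child s).

Definition solves (h : S -> treeAut d) : Prop :=
  forall s, is_psi (h s)
    (map_tuple (fun x => match x with inl g => g | inr s' => h s' end) (sys s)).

Lemma recAut_psi : solves recAut.
Proof. by move=> s i tau; rewrite tnth_map /=; case: (tnth _ _). Qed.

Lemma recAut_uniq h : solves h -> h = recAut.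
Proof.
move=> hP; apply: funext => s; apply: treeAut_ext => w.
elim: w s => [|i w IH] s; first by rewrite !taut_nil.
rewrite hP recAut_psi !tnth_map; case: (tnth _ _) => // s'.
by rewrite IH.
Qed.

End Recursion.

Section Subgroups.
Variable gT : groupType.
Implicit Types (A G H : set gT).

Definition subgroup H : Prop :=
  [/\ H 1, forall x y, H x -> H y -> H (x * y) & forall x, H x -> H x^-1].

Definition generated A : set gT := smallest subgroup A.

Lemma generated_subgroup A : subgroup (generated A).
Proof.
split=> [B [[]]|x y xA yA B BA|x xA B BA] //.
- by case: (BA) => -[_ BM _] _; apply: BM; [exact: xA|exact: yA].
- by case: (BA) => -[_ _ BV] _; apply: BV; exact: xA.
Qed.

Lemma generated_sub A H : subgroup H -> A `<=` H -> generated A `<=` H.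
Proof. by move=> HH AH x; apply. Qed.

Lemma conj_generated A g :
  (forall x, A x -> generated A (x ^ g)) ->
  forall x, generated A x -> generated A (x ^ g).
Proof.
have [G1 GM GV] := generated_subgroup A.
move=> Ag; apply: generated_sub => //; split=> [|x y xg yg|x xg].
- by rewrite conj1g.
- by rewrite conjMg; exact: GM.
- by rewrite conjVg; exact: GV.
Qed.

Lemma generated_mul_normal (u v : gT) : u ^+ 3 = 1 -> v ^+ 3 = 1 ->
  forall g x, generated [set u; v] g ->
    generated [set u * v; v * u] x -> generated [set u * v; v * u] (x ^ g).
Proof.
have cub (w : gT) : w ^+ 3 = 1 -> w^-1 = w * w.
  move=> w3; have : w^-1 * w ^+ 3 = w * w by rewrite !expgS mulKg mulg1.
  by rewrite w3 mulg1.
move=> /cub u3 /cub v3; set N := generated [set u * v; v * u].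
have [N1 NM NV] : subgroup N := generated_subgroup _.
have Nuv : N (u * v) by apply: sub_gen_smallest; left.
have Nvu : N (v * u) by apply: sub_gen_smallest; right.
have step (w : gT) : w^-1 = w * w -> N ((u * v) ^ w) -> N ((v * u) ^ w) ->
    forall x, N x -> N (x ^ w) /\ N (x ^ w^-1).
  move=> w3 h1 h2; have Nw : forall x, N x -> N (x ^ w).
    by apply: conj_generated => y [->|->].
  by move=> x Nx; split; [exact: Nw|rewrite w3 conjgM; apply: (Nw); apply: Nw].
suff : generated [set u; v] `<=` [set g | forall x, N x -> N (x ^ g) /\ N (x ^ g^-1)].
  by move=> sub g x /sub /(_ x) h /h[].
apply: generated_sub; first split=> [x Nx|g h gP hP x Nx|g gP x Nx] /=.
- by rewrite invg1 conjg1.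
- rewrite invgM !conjgM; split.
    by apply: (proj1 (hP _ _)); apply: (proj1 (gP _ _)).
  by apply: (proj2 (gP _ _)); apply: (proj2 (hP _ _)).
- by rewrite invgK; case: (gP x Nx).
have sq (w : gT) : w^-1 = w * w -> w^-1 * w^-1 = w.
  by move=> w3; rewrite -invgM -w3 invgK.
have e1 : (u * v) ^ u = v * u by rewrite conjgE mulgA mulKg.
have e2 : (v * u) ^ v = u * v by rewrite conjgE mulgA mulKg.
have e3 : (v * u) ^ u = (v * u)^-1 * (u * v)^-1.
  by rewrite conjgE !invgM -!mulgA -u3 [v^-1 * (v^-1 * _)]mulgA sq // v3.
have e4 : (u * v) ^ v = (u * v)^-1 * (v * u)^-1.
  by rewrite conjgE !invgM -!mulgA -v3 [u^-1 * (u^-1 * _)]mulgA sq // u3.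
move=> g [->|->]; apply: step => //; rewrite ?e1 ?e2 ?e3 ?e4 //;
  by apply: NM; apply: NV.
Qed.

Definition lcosets G H : set (set gT) := [set [set x * h | h in H] | x in G].

Definition torsion_free H : Prop :=
  forall (x : gT) (n : nat), H x -> (0 < n)%N -> x ^+ n = 1 -> x = 1.

End Subgroups.

Definition a2 : treeAut 2 := root_cycle 2.

Inductive bcd := stB | stC | stD.

Definition grig_sys (s : bcd) : 2.-tuple (treeAut 2 + bcd) :=
  match s with
  | stB => [tuple inl a2; inr stC]
  | stC => [tuple inl a2; inr stD]
  | stD => [tuple inl 1; inr stB]
  end.

Definition gb := recAut grig_sys stB.
Definition gc := recAut grig_sys stC.
Definition gd := recAut grig_sys stD.

Definition Grig : set (treeAut 2) := generated [set a2; gb; gc; gd].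

Definition tgrig_sys (s : bcd) : 2.-tuple (treeAut 2 + bcd) :=
  match s with
  | stB => [tuple inl a2; inr stC]
  | stC => [tuple inl 1; inr stD]
  | stD => [tuple inl 1; inr stB]
  end.

Definition tb := recAut tgrig_sys stB.
Definition tc := recAut tgrig_sys stC.
Definition td := recAut tgrig_sys stD.

Definition TGrig : set (treeAut 2) := generated [set a2; tb; tc; td].

Definition a3 : treeAut 3 := root_cycle 3.

Definition r3 : treeAut 3 :=
  recAut (fun _ : unit => [tuple inl a3; inl 1; inr tt]) tt.
Definition s3 : treeAut 3 :=
  recAut (fun _ : unit => [tuple inl a3; inl a3; inr tt]) tt.
Definition t3 : treeAut 3 :=
  recAut (fun _ : unit => [tuple inl a3; inl a3^-1; inr tt]) tt.

Definition Gamma : set (treeAut 3) := generated [set a3; r3].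
Definition GammaBar : set (treeAut 3) := generated [set a3; s3].
Definition GammaBarBar : set (treeAut 3) := generated [set a3; t3].

(* Normality is proved in K_normal and KBar_normal.  The two groups do not depend
   on the convention for composition: exchanging the factors in every product
   merely permutes the generators. *)
Definition K : set (treeAut 3) := generated [set a3 * r3; r3 * a3].
Definition KBar : set (treeAut 3) := generated [set s3 * a3^-1; a3^-1 * s3].

Lemma eq_psi d (h : treeAut d) hs hs' : hs = hs' -> is_psi h hs -> is_psi h hs'.
Proof. by move=> ->. Qed.

Lemma psi_gb : is_psi gb [tuple a2; gc].
Proof. by apply: eq_psi (recAut_psi _ _); apply: val_inj. Qed.

Lemma psi_gc : is_psi gc [tuple a2; gd].
Proof. by apply: eq_psi (recAut_psi _ _); apply: val_inj. Qed.

Lemma psi_gd : is_psi gd [tuple 1; gb].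
Proof. by apply: eq_psi (recAut_psi _ _); apply: val_inj. Qed.

Lemma psi_tb : is_psi tb [tuple a2; tc].
Proof. by apply: eq_psi (recAut_psi _ _); apply: val_inj. Qed.

Lemma psi_tc : is_psi tc [tuple 1; td].
Proof. by apply: eq_psi (recAut_psi _ _); apply: val_inj. Qed.

Lemma psi_td : is_psi td [tuple 1; tb].
Proof. by apply: eq_psi (recAut_psi _ _); apply: val_inj. Qed.

Lemma psi_r3 : is_psi r3 [tuple a3; 1; r3].
Proof. by apply: eq_psi (recAut_psi _ _); apply: val_inj. Qed.

Lemma psi_s3 : is_psi s3 [tuple a3; a3; s3].
Proof. by apply: eq_psi (recAut_psi _ _); apply: val_inj. Qed.

Lemma psi_t3 : is_psi t3 [tuple a3; a3^-1; t3].
Proof. by apply: eq_psi (recAut_psi _ _); apply: val_inj. Qed.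

Lemma a3_cube : a3 ^+ 3 = 1.
Proof.
apply: treeAut_ext => -[|i w] //; rewrite !expgS !mul_tautE /=.
by congr (_ :: _); apply: val_inj; case: i => -[|[|[]]].
Qed.

Lemma cube_psi (g x y : treeAut 3) : x ^+ 3 = 1 -> y ^+ 3 = 1 ->
  is_psi g [tuple x; y; g] -> g ^+ 3 = 1.
Proof.
move=> x3 y3 gP; apply: treeAut_ext.
have cubE (h : treeAut 3) : h ^+ 3 = 1 -> forall w, h (h (h w)) = w.
  by move=> h3 w; rewrite -[RHS]one_tautE -h3 !expgS.
elim=> [|i w IH]; first by rewrite taut_nil.
rewrite !expgS !mul_tautE !gP; congr (_ :: _).
case: i => -[|[|[|//]]] ? /=; rewrite !(tnth_nth 1) /=.
- exact: cubE.
- exact: cubE.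
- by move: IH; rewrite !expgS.
Qed.

Lemma K_normal g x : Gamma g -> K x -> K (x ^ g).
Proof.
apply: generated_mul_normal; first exact: a3_cube.
by apply: cube_psi psi_r3; [exact: a3_cube|rewrite expg1n].
Qed.

Lemma KBar_normal g x : GammaBar g -> KBar x -> KBar (x ^ g).
Proof.
move=> Gg; apply: generated_mul_normal.
- by apply: cube_psi psi_s3; exact: a3_cube.
- by rewrite expVgn a3_cube invg1.
have HG := generated_subgroup [set s3; a3^-1].
apply: generated_sub g Gg => // y [->|->].
- have [_ _ GV] := HG.
  by have /GV : generated [set s3; a3^-1] a3^-1;
    [apply: sub_gen_smallest; right|rewrite invgK].
- by apply: sub_gen_smallest; left.
Qed.

(* Main.v *)
(* Every automorphism g of the ternary tree occurring here acts below each vertex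
   u by adding some r(u) in Z/3 to the next letter.  These portraits satisfy
     sum_j r(u i j) = r(u (i+1))                          on Gamma,
     sum_j r(u i j) = 2 r(u i) + r(u (i+1)) + r(u (i+2))  on GammaBar,
   relations which are stable under products and inverses, and on K and KBar
   moreover r(root) = sum_i r(i).  Let g^3 = 1 and let g fix u, with
   r(u) = sum_i r(u i).  If r(u) <> 0, then g permutes the children of u
   cyclically and g^3 = 1 forces sum_i r(u i) = 0, a contradiction.  So r(u) = 0,
   g fixes the children of u, and the relations give r(u i) = sum_j r(u i j) (on
   Gamma, by excluding that r(u i) and r(u (i+1)) are both nonzero, again with
   g^3 = 1); by induction g = 1.  Elements of order prime to 3 are trivial, hence K and KBar
   are torsion-free; they contain no nontrivial power of a, so have index 3.

   For (c), write D_i(x) for the automorphism acting as x below the letter i and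
   trivially elsewhere.  The group contains a subgroup N which is stable under
   D_i and contains D_j(x), for some i <> j and x <> 1 of finite order.  The
   elements D_i^n(D_j(x)) commute pairwise; two of them share a coset of any
   subgroup of finite index, which thus contains their nontrivial torsion
   quotient.  For Grigorchuk's group, N is the normal closure of [b, a], and the
   overgroup contains Grigorchuk's group since b = d~ b~, c = b~ c~, d = c~ d~;
   for the Gupta-Sidki group, N is the derived subgroup. *)
Require Import Defs.
From mathcomp Require Import all_boot ssralg zmodp.
From mathcomp Require Import all_classical.

Set Implicit Arguments.
Unset Strict Implicit.
Unset Printing Implicit Defensive.

Import GRing.Theory.

Local Open Scope classical_set_scope.
Local Open Scope card_scope.
Local Open Scope group_scope.

(** * Cosets *)

Section CosetCounting.
Variables (gT : groupType) (A H : set gT) (a : gT).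
Hypotheses (HH : subgroup H) (acube : a ^+ 3 = 1).

Lemma lcoset_eq (x y : gT) :
  [set x * h | h in H] = [set y * h | h in H] -> H (x^-1 * y).
Proof.
case: HH => H1 _ _ xy; have : [set y * h | h in H] y by exists 1; rewrite ?mulg1.
by rewrite -xy => -[h Hh <-]; rewrite mulKg.
Qed.

Lemma eq_lcoset (x y : gT) :
  H (x^-1 * y) -> [set x * h | h in H] = [set y * h | h in H].
Proof.
case: HH => _ HM HV Hxy; apply/seteqP; split=> _ [h Hh <-].
- exists (y^-1 * x * h); last by rewrite !mulgA mulgV mul1g.
  by apply: HM => //; rewrite -[x]invgK -invgM; exact: HV.
- by exists (x^-1 * y * h); [exact: HM|rewrite !mulgA mulgV mul1g].
Qed.

(** Since H is normalized, the elements g with a^k g in H for some k form a subgroup; hence 1, a,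
    a^2 represent all cosets. They are distinct because a, and with it a^2, lies outside H. *)
Lemma lcosets_card3 : generated A a -> ~ H a ->
  (forall g x, generated A g -> H x -> H (x ^ g)) ->
  (forall x, A x -> exists k, H (a ^+ k * x)) ->
  lcosets (generated A) H #= `I_3.
Proof.
move=> Ga Ha nH Ax; have [H1 HM HV] := HH.
have [G1 GM GV] := generated_subgroup A.
have GX k : generated A (a ^+ k).
  by elim: k => [|k IH]; rewrite ?expg0 // expgS; exact: GM.
have aX k : a ^+ k = a ^+ (k %% 3).
  by rewrite {1}(divn_eq k 3) expgnDr mulnC expgnA acube expg1n mul1g.
(* Exponents are natural numbers, so [k * 2] stands for -k modulo 3. *)
have aV k : (a ^+ k)^-1 = a ^+ (k * 2).
  by apply: (mulgI (a ^+ k)); rewrite mulgV -expgnDr -mulnS mulnC expgnA acube expg1n.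
have cover g : generated A g -> exists k, H (a ^+ k * g).
  apply: (@generated_sub _ A [set g | exists k, H (a ^+ k * g)]) => //.
  split=> [|x y [k Hx] [l Hy]|x [k Hx]].
  - by exists 0; rewrite expg0 mulg1.
  - exists (k + l)%N; suff -> : a ^+ (k + l) * (x * y) =
        (a ^+ k * x) ^ (a ^+ l)^-1 * (a ^+ l * y).
      by apply: HM => //; apply: nH => //; exact: GV.
    by rewrite addnC expgnDr conjgE invgK -!mulgA mulKg.
  - exists (k * 2)%N; rewrite -aV.
    suff -> : (a ^+ k)^-1 * x^-1 = ((a ^+ k * x)^-1) ^ (a ^+ k).
      by apply: nH => //; exact: HV.
    by rewrite conjgE invgM -!mulgA mulVg mulg1.
pose f k := [set a ^+ k * h | h in H].
have -> : lcosets (generated A) H = f @` `I_3.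
  apply/seteqP; split=> [C [g /cover[k Hg] <-]|C [k _ <-]]; last by exists (a ^+ k).
  exists ((k * 2) %% 3) => /=; first exact: ltn_mod.
  by apply: eq_lcoset; rewrite -aX -aV invgK.
apply: inj_card_eq.
suff neq i j : (i < j < 3)%N -> f i <> f j.
  move=> i j; rewrite !inE /= => i3 j3 fij.
  case: (ltngtP i j) => // ij; [case: (neq i j) => //|case: (neq j i) => //].
    by rewrite ij.
  by rewrite ij.
move=> /andP[ij j3] /lcoset_eq; rewrite -(subnKC (ltnW ij)) expgnDr mulKg.
have : (0 < j - i < 3)%N by rewrite subn_gt0 ij (leq_ltn_trans (leq_subr _ _)).
case: (j - i) => [|[|[|//]]] // _.
move=> Ha2; apply: Ha; have -> : a = (a ^+ 2)^-1 by rewrite aV aX expg1.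
exact: HV.
Qed.

End CosetCounting.

(** * Portraits over Z/3 *)

Definition portrait (g : treeAut 3) (r : vertex 3 -> 'I_3) : Prop :=
  forall u i, g (rcons u i) = rcons (g u) (i + r u)%R.

Definition child_sum (r : vertex 3 -> 'I_3) (u : vertex 3) : 'I_3 :=
  (\sum_j r (rcons u j))%R.

(** The coefficients depend only on the difference of two letters, so the relation is invariant
    under translating the letters below u, which is how an automorphism with a portrait acts there.
    One form serves both groups. *)
Definition constrained (c : 'I_3 -> 'I_3) (r : vertex 3 -> 'I_3) : Prop :=
  forall u i, child_sum r (rcons u i) = (\sum_k c k * r (rcons u (i + k)))%R.

Section Portraits.
Implicit Types (g h : treeAut 3) (r s : vertex 3 -> 'I_3).

Lemma portrait1 : portrait 1 (fun=> 0%R).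
Proof. by move=> u i; rewrite addr0. Qed.

Lemma portraitM g h r s : portrait g r -> portrait h s ->
  portrait (g * h) (fun u => r (h u) + s u)%R.
Proof. by move=> gr hs u i; rewrite !mul_tautE hs gr -addrA [(s u + _)%R]addrC. Qed.

Lemma portraitV g r : portrait g r -> portrait g^-1 (fun u => - r (g^-1%g u))%R.
Proof.
move=> gr u i; apply: (bij_inj (taut_bij g)).
by rewrite gr -!mul_tautE mulgV !one_tautE addrNK.
Qed.

Lemma portrait_inj g r s : portrait g r -> portrait g s -> r =1 s.
Proof.
move=> gr gs u; have := gr u 0%R; rewrite gs => e.
by have /addrI -> := rcons_injr _ e.
Qed.

(** The map j -> j + s u carries the children of u to those of h u, so the first sum is only
    reindexed. *)
Lemma child_sumM g h r s u : portrait h s ->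
  child_sum (fun v => r (h v) + s v)%R u = (child_sum r (h u) + child_sum s u)%R.
Proof.
move=> hs; rewrite /child_sum big_split /=; congr (_ + _)%R.
rewrite [RHS](reindex_inj (addIr (s u))) /=.
by apply: eq_bigr => j _; rewrite hs.
Qed.

Lemma child_sumV g r u : portrait g r ->
  child_sum (fun v => - r (g^-1%g v))%R u = (- child_sum r (g^-1%g u))%R.
Proof.
move=> /portraitV gr; rewrite /child_sum sumrN; congr (- _)%R.
rewrite [RHS](reindex_inj (addIr (- r (g^-1%g u))%R)) /=.
by apply: eq_bigr => j _; rewrite gr.
Qed.

Lemma constrainedM c g h r s : portrait h s -> constrained c r ->
  constrained c s -> constrained c (fun u => r (h u) + s u)%R.
Proof.
move=> hs cr cs u i; rewrite child_sumM // hs cr cs -big_split /=.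
by apply: eq_bigr => k _; rewrite mulrDr hs addrAC.
Qed.

Lemma constrainedV c g r : portrait g r -> constrained c r ->
  constrained c (fun u => - r (g^-1%g u))%R.
Proof.
move=> gr cr u i; rewrite (child_sumV _ gr) (portraitV gr) cr -sumrN.
by apply: eq_bigr => k _; rewrite mulrN (portraitV gr) addrAC.
Qed.

(* x is the exponent sum of a in g modulo 3, while y is that of r for Gamma, and
   minus that of s for GammaBar, because psi(s) has two components a. *)
Definition root_type (c : 'I_3 -> 'I_3) (x y : 'I_3) (g : treeAut 3) : Prop :=
  exists r, [/\ portrait g r, constrained c r, r [::] = x & child_sum r [::] = y].

Arguments root_type c (x y)%_ring_scope g.

Lemma root_type1 c : root_type c 0 0 1.
Proof.
exists (fun=> 0%R); split=> [|u i||]; [exact: portrait1| |by []|].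
  by rewrite /child_sum !big1 // => k _; rewrite mulr0.
by rewrite /child_sum big1.
Qed.

Lemma root_typeM c x y x' y' g h : root_type c x y g -> root_type c x' y' h ->
  root_type c (x + x') (y + y') (g * h).
Proof.
move=> [r [gr cr <- <-]] [s [hs cs <- <-]].
exists (fun u => r (h u) + s u)%R; split; first exact: portraitM.
- exact: constrainedM.
- by rewrite taut_nil.
- by rewrite child_sumM // taut_nil.
Qed.

Lemma root_typeV c x y g : root_type c x y g -> root_type c (- x) (- y) g^-1.
Proof.
move=> [r [gr cr <- <-]].
exists (fun u => - r (g^-1%g u))%R; split; first exact: portraitV.
- exact: constrainedV.
- by rewrite taut_nil.
- by rewrite (child_sumV _ gr) taut_nil.
Qed.

(** A linear condition at the root, which cuts out a subgroup containing K or KBar for the right c;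
    torsion-freeness is proved for this subgroup. *)
Definition balanced (c : 'I_3 -> 'I_3) : set (treeAut 3) :=
  [set g | exists x, root_type c x x g].

Lemma balanced_subgroup c : subgroup (balanced c).
Proof.
split=> [|g h [x gx] [y hy]|g [x gx]].
- by exists 0%R; exact: root_type1.
- by exists (x + y)%R; exact: root_typeM.
- by exists (- x)%R; exact: root_typeV.
Qed.

Lemma sum_ord3 (F : 'I_3 -> 'I_3) : (\sum_k F k = F 0 + F 1 + F (1 + 1))%R.
Proof.
rewrite !big_ord_recl big_ord0 addr0 addrA.
by congr (_ + F _ + F _)%R; apply: val_inj.
Qed.

Lemma child_sumE r u :
  child_sum r u = (r (rcons u 0) + r (rcons u 1) + r (rcons u (1 + 1)))%R.
Proof. exact: sum_ord3. Qed.

Lemma ord3P (P : 'I_3 -> Prop) : P 0%R -> P 1%R -> P (1 + 1)%R -> forall i, P i.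
Proof.
move=> P0 P1 P2 [[|[|[|//]]] lti].
- by rewrite (_ : Ordinal _ = 0%R) //; apply: val_inj.
- by rewrite (_ : Ordinal _ = 1%R) //; apply: val_inj.
- by rewrite (_ : Ordinal _ = (1 + 1)%R) //; apply: val_inj.
Qed.

(** * Torsion of automorphisms with a portrait *)

Lemma expg3E g w : (g ^+ 3) w = g (g (g w)).
Proof. by rewrite !expgS. Qed.

(* g runs through the three children of u, so the sum is the portrait of g^3 at one
   of them. *)
Lemma cube_child_sum g r u : portrait g r -> g ^+ 3 = 1 -> g u = u ->
  r u <> 0%R -> child_sum r u = 0%R.
Proof.
move=> gr g3 gu ru.
have := portraitM gr (portraitM gr gr).
rewrite (_ : g * (g * g) = 1); last by rewrite -g3 !expgS expg0 mulg1.
move=> /portrait_inj/(_ portrait1)/(_ (rcons u 0%R)).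
rewrite child_sumE mul_tautE !gr !gu add0r.
elim/ord3P: (r u) ru => // _.
  by move=> e; rewrite -[RHS]e addrC; congr (_ + _)%R; rewrite addrC.
rewrite (_ : 1 + 1 + (1 + 1) = 1 :> 'I_3)%R; last exact: val_inj.
by move=> e; rewrite -[RHS]e -addrA addrCA; congr (_ + _)%R; rewrite addrC.
Qed.

(** The induction along u carries g u = u together with r u = child_sum r u. By [cube_child_sum] the
    second equality excludes r u <> 0, so g fixes the children of u, and the last hypothesis passes
    the equality on to them. *)
Lemma cube_trivial g r : portrait g r -> g ^+ 3 = 1 ->
  r [::] = child_sum r [::] ->
  (forall u, g u = u -> r u = 0%R -> child_sum r u = 0%R ->
     forall i, r (rcons u i) = child_sum r (rcons u i)) ->
  g = 1.
Proof.
move=> gr g3 r0 rS; apply: treeAut_ext => u; rewrite one_tautE.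
suff [] : g u = u /\ r u = child_sum r u by [].
elim/last_ind: u => [|u i [gu ru]]; first by rewrite taut_nil.
have ru0 : r u = 0%R.
  by apply: contrapT => /[dup] /(cube_child_sum gr g3 gu); rewrite -ru.
by rewrite gr gu ru0 addr0; split=> //; apply: rS => //; rewrite -ru.
Qed.

(** If g fixes u, then g^n adds n r(u) to the next letter. For n prime to 3 this forces r(u) = 0, so
    g fixes the children of u as well. *)
Lemma portrait_torsion g r n : portrait g r -> g ^+ n = 1 -> ~~ (3 %| n) -> g = 1.
Proof.
move=> gr gn n3; apply: treeAut_ext => u; rewrite one_tautE.
elim/last_ind: u => [|u i gu]; first by rewrite taut_nil.
have gm m : (g ^+ m) (rcons u i) = rcons u (i + r u *+ m)%R.
  elim: m => [|m IH]; first by rewrite addr0.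
  by rewrite expgS mul_tautE IH gr gu mulrSr addrA.
rewrite gr gu; congr (rcons u _).
have rn : (r u *+ n = 0)%R.
  have := gm n; rewrite gn one_tautE => e.
  by apply: (addrI i); rewrite -(rcons_injr _ e) addr0.
suff -> : r u = 0%R by rewrite addr0.
have : (r u *+ (n %% 3) = 0)%R.
  move: rn; rewrite {1}(divn_eq n 3) mulrnDr mulnC mulrnA.
  suff -> : (r u *+ 3 = 0)%R by rewrite mul0rn add0r.
  by elim/ord3P: (r u); apply: val_inj.
move: n3 (ltn_pmod n (isT : 0 < 3)%N); rewrite /dvdn.
case: (n %% 3) => [|[|[|//]]] // _ _; elim/ord3P: (r u) => // /(congr1 val).
Qed.

(** If n = 3m, then g^m has cube 1, so it is trivial and m replaces n; otherwise [portrait_torsion]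
    applies. *)
Lemma torsion_free_cube (H : set (treeAut 3)) : subgroup H ->
  (forall g, H g -> exists r, portrait g r) ->
  (forall g, H g -> g ^+ 3 = 1 -> g = 1) -> torsion_free H.
Proof.
move=> [H1 HM _] Hr H3 g n Hg.
have HX m : H (g ^+ m).
  by elim: m => [|m IH]; rewrite ?expg0 // expgS; exact: HM.
elim/ltn_ind: n => n IH n0 gn.
have [|n3] := boolP (3 %| n); last first.
  by have [r gr] := Hr _ Hg; exact: portrait_torsion gr gn n3.
case/dvdnP => m nm; move: n0 gn; rewrite nm muln_gt0 expgnA => /andP[m0 _] gm.
by apply: (IH m) => //; [rewrite nm ltn_Pmulr|exact: H3].
Qed.

Lemma balanced_torsion_free c :
  (forall g r, portrait g r -> constrained c r -> g ^+ 3 = 1 ->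
     forall u, g u = u -> r u = 0%R -> child_sum r u = 0%R ->
     forall i, r (rcons u i) = child_sum r (rcons u i)) ->
  torsion_free (balanced c).
Proof.
move=> cP; apply: torsion_free_cube; first exact: balanced_subgroup.
  by move=> g [x [r [gr _ _ _]]]; exists r.
move=> g [x [r [gr cr rx sx]]] g3; apply: (cube_trivial gr) => //.
  by rewrite rx sx.
exact: cP.
Qed.

(** * Portraits of the generators *)

Fixpoint rec_portrait (p q : vertex 3 -> 'I_3) (w : vertex 3) : 'I_3 :=
  if w is i :: tau then
    match val i with 0 => p tau | 1 => q tau | _ => rec_portrait p q tau end
  else 0%R.

Lemma portrait_rec g x y p q : is_psi g [tuple x; y; g] ->
  portrait x p -> portrait y q -> portrait g (rec_portrait p q).
Proof.
move=> gP xp yq; elim=> [|k u IH] i.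
  by rewrite taut_nil gP taut_nil addr0.
rewrite rcons_cons !gP rcons_cons; congr (_ :: _).
by elim/ord3P: k.
Qed.

(** Away from the root the relation is inherited from the components, the third one being covered by
    induction on the word. *)
Lemma constrained_rec c p q : constrained c p -> constrained c q ->
  (forall i, child_sum (rec_portrait p q) [:: i] =
     \sum_k c k * rec_portrait p q [:: (i + k)%R])%R ->
  constrained c (rec_portrait p q).
Proof.
move=> cp cq c0; elim=> [//|k u IH] i; elim/ord3P: k.
- exact: cp.
- exact: cq.
- exact: IH.
Qed.

Lemma root_type_rec c g x y p q : is_psi g [tuple x; y; g] ->
  portrait x p -> portrait y q -> constrained c p -> constrained c q ->
  (forall i, child_sum (rec_portrait p q) [:: i] =
     \sum_k c k * rec_portrait p q [:: (i + k)%R])%R ->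
  root_type c 0 (p [::] + q [::]) g.
Proof.
move=> gP xp yq cp cq c0; exists (rec_portrait p q); split=> //.
- exact: portrait_rec.
- exact: constrained_rec.
- by rewrite child_sumE /= addr0.
Qed.

Definition portrait_a3 (u : vertex 3) : 'I_3 := if u is [::] then 1%R else 0%R.

Lemma portrait_a3P : portrait a3 portrait_a3.
Proof.
case=> [|k u] i /=; last by rewrite addr0.
by congr [:: _]; elim/ord3P: i; apply: val_inj.
Qed.

Lemma constrained_a3 c : constrained c portrait_a3.
Proof.
move=> u i; rewrite /child_sum !big1 // => k _; case: u => // *.
- by rewrite mulr0.
- by rewrite mulr0.
Qed.

Lemma root_type_a3 c : root_type c 1 0 a3.
Proof.
exists portrait_a3; split=> //; first exact: portrait_a3P.
  exact: constrained_a3.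
by rewrite /child_sum big1.
Qed.

(** At the letters 0, 1, 2 the portrait of r has values 1, 0, 0 and child sums 0, 0, 1; that of s
    has values 1, 1, 0 and child sums 0, 0, 2. The coefficients express the second triple by cyclic
    shifts of the first. *)
Definition cGamma (k : 'I_3) : 'I_3 := if k == 1%R then 1%R else 0%R.
Definition cGammaBar (k : 'I_3) : 'I_3 := if k == 0%R then (1 + 1)%R else 1%R.

Lemma root_type_r3 : root_type cGamma 0 1 r3.
Proof.
have := root_type_rec (c := cGamma) psi_r3 portrait_a3P portrait1.
rewrite addr0; apply; first exact: constrained_a3.
  by move=> u i; rewrite /child_sum !big1 // => k _; rewrite mulr0.
by move=> i; rewrite child_sumE sum_ord3; elim/ord3P: i; apply: val_inj.
Qed.

Lemma root_type_s3 : root_type cGammaBar 0 (1 + 1) s3.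
Proof.
apply: (root_type_rec (c := cGammaBar) psi_s3 portrait_a3P portrait_a3P).
- exact: constrained_a3.
- exact: constrained_a3.
by move=> i; rewrite child_sumE sum_ord3; elim/ord3P: i; apply: val_inj.
Qed.

(** The types of a and r are (1, 0) and (0, 1), so both generators of K have type (1, 1). *)
Lemma K_balanced : K `<=` balanced cGamma.
Proof.
apply: generated_sub; first exact: balanced_subgroup.
move=> g [->|->]; exists 1%R.
  by have := root_typeM (root_type_a3 _) root_type_r3; rewrite addr0 add0r.
by have := root_typeM root_type_r3 (root_type_a3 _); rewrite addr0 add0r.
Qed.

Lemma KBar_balanced : KBar `<=` balanced cGammaBar.
Proof.
have aV := root_typeV (root_type_a3 cGammaBar).
apply: generated_sub; first exact: balanced_subgroup.
move=> g [->|->]; exists (1 + 1)%R.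
  have := root_typeM root_type_s3 aV; rewrite oppr0 addr0 add0r.
  by rewrite (_ : - 1 = 1 + 1 :> 'I_3)%R //; apply: val_inj.
have := root_typeM aV root_type_s3; rewrite oppr0 addr0 add0r.
by rewrite (_ : - 1 = 1 + 1 :> 'I_3)%R //; apply: val_inj.
Qed.

(** Each child u k is fixed and its child sum is r(u (k+1)), so by [cube_child_sum] no two
    cyclically consecutive children have nonzero values. Thus at most one of the three values is
    nonzero; as their sum is 0, all vanish. *)
Lemma balanced_cGamma_torsion_free : torsion_free (balanced cGamma).
Proof.
apply: balanced_torsion_free => g r gr cr g3 u gu ru su i.
have cE k : child_sum r (rcons u k) = r (rcons u (k + 1)%R).
  by rewrite cr sum_ord3 /= mul0r mul1r mul0r addr0 add0r.
have step k : (r (rcons u k) == 0%R) || (r (rcons u (k + 1)%R) == 0%R).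
  rewrite -cE; have [//|/eqP rk] := eqVneq; apply/eqP.
  by apply: cube_child_sum => //; rewrite gr gu ru addr0.
rewrite cE; have := step i; have := step (i + 1)%R; have := step (i + 1 + 1)%R.
have : (r (rcons u i) + r (rcons u (i + 1)) + r (rcons u (i + 1 + 1)) = 0)%R.
  by rewrite -su /child_sum (reindex_inj (addrI i)) sum_ord3 /= addr0 addrA.
rewrite (_ : i + 1 + 1 + 1 = i)%R; last first.
  by rewrite -!addrA -[RHS]addr0; congr (_ + _)%R; apply: val_inj.
move: (r (rcons u i)) (r (rcons u (i + 1)%R)) (r (rcons u (i + 1 + 1)%R)).
by move=> x y z; elim/ord3P: x; elim/ord3P: y; elim/ord3P: z.
Qed.

(** The relation says that the child sum at u i is r(u i) plus the child sum at u, and the latter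
    vanishes. *)
Lemma balanced_cGammaBar_torsion_free : torsion_free (balanced cGammaBar).
Proof.
apply: balanced_torsion_free => g r gr cr g3 u gu ru su i.
rewrite cr.
have -> : (\sum_k cGammaBar k * r (rcons u (i + k)) =
   r (rcons u i) + child_sum r u)%R.
  rewrite /child_sum [in RHS](reindex_inj (addrI i)) !sum_ord3 /= addr0.
  by rewrite !mul1r mulrDl !mul1r !addrA.
by rewrite su addr0.
Qed.

Lemma K_torsion_free : torsion_free K.
Proof. by move=> g n /K_balanced; exact: balanced_cGamma_torsion_free. Qed.

Lemma KBar_torsion_free : torsion_free KBar.
Proof. by move=> g n /KBar_balanced; exact: balanced_cGammaBar_torsion_free. Qed.

End Portraits.

(** * Rigid copies of automorphisms below a letter *)

Section Branching.
Variable d : nat.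
Implicit Types (i j : 'I_d) (x y g h : treeAut d).

(** The D_i(x) of the overview. All components are known, and [recAut] serves to assemble them into
    an automorphism. *)
Definition branch i x : treeAut d :=
  recAut (fun _ : unit => [tuple inl (if k == i then x else 1) | k < d]) tt.

Lemma branchE i x k w : branch i x (k :: w) = k :: if k == i then x w else w.
Proof. by rewrite recAut_psi tnth_map tnth_mktuple; case: ifP. Qed.

Lemma branch_self i x w : branch i x (i :: w) = i :: x w.
Proof. by rewrite branchE eqxx. Qed.

Lemma branch_other i k x w : k != i -> branch i x (k :: w) = k :: w.
Proof. by rewrite branchE => /negPf->. Qed.

Lemma branchM i x y : branch i (x * y) = branch i x * branch i y.
Proof.
apply: treeAut_ext => -[|k w]; first by rewrite !taut_nil.
by rewrite mul_tautE !branchE; case: ifP.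
Qed.

Lemma branch1 i : branch i 1 = 1.
Proof.
apply: treeAut_ext => -[|k w]; first by rewrite !taut_nil.
by rewrite branchE; case: ifP.
Qed.

Lemma branchV i x : branch i x^-1 = (branch i x)^-1.
Proof. by apply: (mulgI (branch i x)); rewrite -branchM !mulgV branch1. Qed.

Lemma branchX i x n : branch i (x ^+ n) = branch i x ^+ n.
Proof. by elim: n => [|n IH]; rewrite ?branch1 // !expgS branchM IH. Qed.

Lemma branch_inj i : injective (branch i).
Proof.
move=> x y xy; apply: treeAut_ext => w.
by have := congr1 (fun g : treeAut d => g (i :: w)) xy; rewrite !branchE eqxx => -[].
Qed.

Lemma branch_commute i j x y : i != j -> commute (branch i x) (branch j y).
Proof.
move=> ij; apply: treeAut_ext => -[|k w]; first by rewrite !taut_nil.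
rewrite !mul_tautE !branchE; have [->|//] := eqVneq k i.
by rewrite (negPf ij).
Qed.

Lemma branch_conj i x g h : (forall w, h (i :: w) = i :: g w) ->
  branch i (x ^ g) = branch i x ^ h.
Proof.
move=> hg; apply: (mulgI h); rewrite [_ ^ h]conjgE mulVKg.
apply: treeAut_ext => -[|k w]; first by rewrite !taut_nil.
rewrite !mul_tautE branchE; case: eqP => [->|ki].
  by rewrite !hg branchE eqxx -mul_tautE conjgE mulVKg.
case hkw: (h (k :: w)) => [|l v].
  by move: hkw; rewrite -(taut_nil h) => /(bij_inj (taut_bij h)).
rewrite branchE; case: eqP => // li.
have [h' hK _] := taut_bij h; case: ki.
(* If h moved k w with k <> i to i v, then i (g^-1 v) would have the same image. *)
have : h (i :: g^-1 v) = h (k :: w) by rewrite hg hkw li -mul_tautE mulgV.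
by move=> /(bij_inj (taut_bij h)) -[].
Qed.

Lemma no_torsion_free (G N : set (treeAut d)) i j x p : i != j ->
  N `<=` G -> (forall y, N y -> N (branch i y)) ->
  N (branch j x) -> (0 < p)%N -> x ^+ p = 1 -> x <> 1 ->
  ~ (exists H, [/\ subgroup H, H `<=` G, finite_set (lcosets G H) & torsion_free H]).
Proof.
move=> ij NG Ni Njx p0 xp x1 [H [HH HG Hfin Htf]].
pose y n := iter n (branch i) (branch j x).
have Ny n : N (y n) by elim: n => //= n; exact: Ni.
pose f n := [set y n * h | h in H].
(* Otherwise n -> y n H would be injective, giving infinitely many cosets. *)
suff fE m n : f m = f n -> (m < n)%N -> False.
  have finj : injective f.
    by move=> m n fmn; case: (ltngtP m n) => // /fE[].
  apply: infinite_nat; rewrite -(preimage_range f).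
  apply: finite_preimage; first by move=> ? ? _ _; exact: finj.
  by apply: sub_finite_set Hfin => _ [n _ <-]; exists (y n) => //; apply: NG.
move=> /(lcoset_eq HH) Hmn mn.
have yD k n' : y (k + n')%N = iter k (branch i) (y n') by rewrite /y iterD.
have iterX k (z : treeAut d) q : iter k (branch i) (z ^+ q) = iter k (branch i) z ^+ q.
  by elim: k => //= k ->; rewrite branchX.
have iterM k (z t : treeAut d) :
    iter k (branch i) (z * t) = iter k (branch i) z * iter k (branch i) t.
  by elim: k => //= k ->; rewrite branchM.
have iterV k (z : treeAut d) : iter k (branch i) z^-1 = (iter k (branch i) z)^-1.
  by elim: k => //= k ->; rewrite branchV.
have iter1 k : iter k (branch i) 1 = 1 by elim: k => //= k ->; rewrite branch1.
have yp n' : y n' ^+ p = 1.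
  by rewrite /y -iterX -branchX xp branch1 iter1.
(* Pulling out the m-fold [branch i] common to y m and y n leaves the quotient of t by [branch j x].
   As n > m, t is itself a [branch i], hence commutes with [branch j x]. *)
move: Hmn; rewrite -(subnKC mn) addSnnS yD -[y m]/(iter m (branch i) (branch j x)).
set t := y _.+1; rewrite -iterV -iterM => Hmt.
have com : commute (branch j x)^-1 t.
  apply/commute_sym/commuteV/commute_sym; rewrite /t /y /=.
  by apply: branch_commute; rewrite eq_sym.
have /(Htf _ p Hmt p0) : iter m (branch i) ((branch j x)^-1 * t) ^+ p = 1.
  by rewrite -iterX expgMn // yp mulg1 expVgn -branchX xp branch1 invg1 iter1.
have injX k : injective (iter k (branch i)).
  by elim: k => //= k IH ? ? /branch_inj; exact: IH.
rewrite -(iter1 m) => /injX jt; apply: x1.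
have {}jt : t = branch j x by rewrite -[t](mulKg (branch j x)^-1) jt mulg1 invgK.
(* Below j the element t is trivial, whereas [branch j x] acts as x. *)
apply: treeAut_ext => w; have := congr1 (fun g : treeAut d => g (j :: w)) jt.
rewrite [t]/(branch i (y (n - m.+1)%N)) !branchE eqxx eq_sym (negPf ij).
by case.
Qed.

(** Reduces N being stable under [branch i] to generators of N up to conjugacy: if each generator of
    the group is the action below i of some group element, conjugation below i is realized by
    conjugation in the group, which N tolerates. *)
Lemma branch_lift (A N : set (treeAut d)) i :
  subgroup N -> (forall g x, generated A g -> N x -> N (x ^ g)) ->
  (forall g, A g -> exists2 h, generated A h & forall w, h (i :: w) = i :: g w) ->
  subgroup [set x | N (branch i x)] /\
  (forall g x, generated A g -> N (branch i x) -> N (branch i (x ^ g))).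
Proof.
move=> [N1 NM NV] nN lift; split.
  split=> [|x y|x] /=.
  - by rewrite branch1.
  - by rewrite branchM; exact: NM.
  - by rewrite branchV; exact: NV.
move=> g x Gg Nx.
have [G1 GM GV] := generated_subgroup A.
suff [h Gh hg] : exists2 h, generated A h & forall w, h (i :: w) = i :: g w.
  by rewrite (branch_conj _ hg); exact: nN.
apply: (@generated_sub _ A
  [set g | exists2 h, generated A h & forall w, h (i :: w) = i :: g w]) => //.
split=> [|u v [h Gh hu] [k Gk kv]|u [h Gh hu]].
- by exists 1.
- by exists (h * k); [exact: GM|move=> w; rewrite !mul_tautE kv hu].
- exists h^-1; first exact: GV.
  move=> w; apply: (bij_inj (taut_bij h)).
  by rewrite hu -!mul_tautE !mulgV !one_tautE.
Qed.

(** Modulo M the generators commute, hence so does everything they generate: for fixed x the y with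
    [x, y] in M form a subgroup, as M is normalized. This is applied to each argument in turn,
    swapping them by inversion. *)
Lemma generated_commutators (A M : set (treeAut d)) : subgroup M ->
  (forall g x, generated A g -> M x -> M (x ^ g)) ->
  (forall x y, A x -> A y -> M [~ x, y]) ->
  forall x y, generated A x -> generated A y -> M [~ x, y].
Proof.
move=> [M1 MM MV] nM AM.
have [G1 GM GV] := generated_subgroup A.
have MR x y : M [~ x, y] -> M [~ y, x] by move=> /MV; rewrite invgR.
have sub x : generated A x -> subgroup [set y | generated A y /\ M [~ x, y]].
  move=> Gx; split=> [|y z [Gy Mxy] [Gz Mxz]|y [Gy Mxy]].
  - by rewrite /= commg1.
  - split; first exact: GM.
    suff -> : [~ x, y * z] = [~ x, z] * [~ x, y] ^ z by apply: MM => //; exact: nM.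
    by rewrite !commgEl conjgM -mulgA [(x^-1 * x ^ y) ^ z]conjMg conjVg mulVKg.
  - split; first exact: GV.
    suff -> : [~ x, y^-1] = ([~ x, y] ^ y^-1)^-1 by apply: MV; apply: nM => //; exact: GV.
    by rewrite !commgEl conjMg -conjgM mulgV conjg1 invgM conjVg invgK.
have genA x : A x -> generated A x by move=> Ax; apply: sub_gen_smallest.
have step x y : A x -> generated A y -> M [~ x, y].
  move=> Ax Gy; have [] // : generated A y /\ M [~ x, y].
  apply: (generated_sub (sub x (genA x Ax))) Gy => z Az.
  by split; [exact: genA|exact: AM].
move=> x y Gx Gy; have [] // : generated A y /\ M [~ x, y].
apply: (generated_sub (sub x Gx)) Gy => z Az; split; first exact: genA.
by apply: MR; exact: step.
Qed.

End Branching.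

Lemma subgroup_conjg (gT : groupType) (H : set gT) x g :
  subgroup H -> H x -> H g -> H (x ^ g).
Proof.
move=> [_ HM HV] Hx Hg; rewrite conjgE.
by apply: (HM); [exact: HV|exact: HM].
Qed.

Lemma subgroup_commg (gT : groupType) (H : set gT) x y :
  subgroup H -> H x -> H y -> H [~ x, y].
Proof.
move=> HH Hx Hy; rewrite commgEl; have [_ HM HV] := HH.
by apply: HM; [exact: HV|exact: subgroup_conjg].
Qed.

(** Carries a copy from one letter to another, so that for a normal subgroup one letter is
    enough. *)
Lemma branch_root_cycle d (i : 'I_d) x :
  branch i x = branch (ordS i) x ^ root_cycle d.
Proof.
apply: (mulgI (root_cycle d)); rewrite conjgE mulVKg.
apply: treeAut_ext => -[|k w]; first by rewrite !taut_nil.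
rewrite !mul_tautE -[root_cycle d (k :: w)]/(ordS k :: w) !branchE.
rewrite (inj_eq (can_inj (@ordSK d))).
by case: (k == i).
Qed.

Lemma section_expg d (h g : treeAut d) i :
  (forall w, h (i :: w) = i :: g w) ->
  forall n w, (h ^+ n) (i :: w) = i :: (g ^+ n) w.
Proof.
by move=> hg; elim=> [//|n IH] w; rewrite !expgS !mul_tautE IH hg.
Qed.

Lemma treeAut_cons_ext d (g h : treeAut d) :
  (forall k w, g (k :: w) = h (k :: w)) -> g = h.
Proof.
by move=> gh; apply: treeAut_ext => -[|k w]; rewrite ?taut_nil.
Qed.

(** * The Grigorchuk group and its overgroup *)

Section Grigorchuk.

Lemma ord2P (P : 'I_2 -> Prop) : P 0%R -> P 1%R -> forall i, P i.
Proof.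
move=> P0 P1 [[|[|//]] lti].
- by rewrite (_ : Ordinal _ = 0%R) //; apply: val_inj.
- by rewrite (_ : Ordinal _ = 1%R) //; apply: val_inj.
Qed.

Lemma a2_0 w : a2 (0%R :: w) = 1%R :: w.
Proof. by congr (_ :: _); apply: val_inj. Qed.
Lemma a2_1 w : a2 (1%R :: w) = 0%R :: w.
Proof. by congr (_ :: _); apply: val_inj. Qed.
Lemma gb_0 w : gb (0%R :: w) = 0%R :: a2 w. Proof. exact: psi_gb. Qed.
Lemma gb_1 w : gb (1%R :: w) = 1%R :: gc w. Proof. exact: psi_gb. Qed.
Lemma gc_0 w : gc (0%R :: w) = 0%R :: a2 w. Proof. exact: psi_gc. Qed.
Lemma gc_1 w : gc (1%R :: w) = 1%R :: gd w. Proof. exact: psi_gc. Qed.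
Lemma gd_0 w : gd (0%R :: w) = 0%R :: w. Proof. exact: psi_gd. Qed.
Lemma gd_1 w : gd (1%R :: w) = 1%R :: gb w. Proof. exact: psi_gd. Qed.
Lemma tb_0 w : tb (0%R :: w) = 0%R :: a2 w. Proof. exact: psi_tb. Qed.
Lemma tb_1 w : tb (1%R :: w) = 1%R :: tc w. Proof. exact: psi_tb. Qed.
Lemma tc_0 w : tc (0%R :: w) = 0%R :: w. Proof. exact: psi_tc. Qed.
Lemma tc_1 w : tc (1%R :: w) = 1%R :: td w. Proof. exact: psi_tc. Qed.
Lemma td_0 w : td (0%R :: w) = 0%R :: w. Proof. exact: psi_td. Qed.
Lemma td_1 w : td (1%R :: w) = 1%R :: tb w. Proof. exact: psi_td. Qed.

Let grigE := (a2_0, a2_1, gb_0, gb_1, gc_0, gc_1, gd_0, gd_1).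
Let tgrigE := (tb_0, tb_1, tc_0, tc_1, td_0, td_1).

Lemma a2K w : a2 (a2 w) = w.
Proof. by case: w => [|k w]; [rewrite !taut_nil|elim/ord2P: k; rewrite !grigE]. Qed.

(** Proved jointly because below the letter 1 the elements b, c, d act as c, d, b. *)
Lemma gbcd_involutive w : [/\ gb (gb w) = w, gc (gc w) = w & gd (gd w) = w].
Proof.
elim: w => [|k w [IHb IHc IHd]]; first by rewrite !taut_nil.
by elim/ord2P: k; rewrite !grigE ?a2K ?IHb ?IHc ?IHd.
Qed.

Lemma gbK w : gb (gb w) = w. Proof. by case: (gbcd_involutive w). Qed.
Lemma gcK w : gc (gc w) = w. Proof. by case: (gbcd_involutive w). Qed.
Lemma gdK w : gd (gd w) = w. Proof. by case: (gbcd_involutive w). Qed.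

Lemma involution_invg (g : treeAut 2) : (forall w, g (g w) = w) -> g^-1 = g.
Proof.
move=> gK; apply: (mulgI g); rewrite mulgV.
by apply: treeAut_ext => w; rewrite mul_tautE gK.
Qed.

Lemma a2V : a2^-1 = a2. Proof. exact/involution_invg/a2K. Qed.
Lemma gbV : gb^-1 = gb. Proof. exact/involution_invg/gbK. Qed.
Lemma gdV : gd^-1 = gd. Proof. exact/involution_invg/gdK. Qed.

Lemma gbcd_commute w :
  [/\ gb (gd w) = gd (gb w), gb (gc w) = gc (gb w) & gc (gd w) = gd (gc w)].
Proof.
elim: w => [|k w [IH1 IH2 IH3]]; first by rewrite !taut_nil.
by elim/ord2P: k; rewrite !grigE ?IH1 ?IH2 ?IH3.
Qed.

(** Start of a chain bounding the order of [b, a]: (a d)^2 acts as b below both letters, (a c)^2 as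
    d a and a d, and [b, a] as a c and c a. *)
Lemma expg_a2_gd : (a2 * gd) ^+ 4 = 1.
Proof.
apply: treeAut_cons_ext => k w; rewrite !expgS expg0 !mul_tautE.
by elim/ord2P: k; rewrite !grigE gbK.
Qed.

Lemma expg_gd_a2 : (gd * a2) ^+ 4 = 1.
Proof.
apply: treeAut_cons_ext => k w; rewrite !expgS expg0 !mul_tautE.
by elim/ord2P: k; rewrite !grigE gbK.
Qed.

Lemma expg_a2_gc : (a2 * gc) ^+ 8 = 1.
Proof.
rewrite (expgnA _ 2 4); apply: treeAut_cons_ext; elim/ord2P => w.
  rewrite (section_expg (g := gd * a2)) ?expg_gd_a2 // => {}w.
  by rewrite expgS !mul_tautE !grigE.
rewrite (section_expg (g := a2 * gd)) ?expg_a2_gd // => {}w.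
by rewrite expgS !mul_tautE !grigE.
Qed.

Lemma expg_gc_a2 : (gc * a2) ^+ 8 = 1.
Proof.
rewrite (expgnA _ 2 4); apply: treeAut_cons_ext; elim/ord2P => w.
  rewrite (section_expg (g := a2 * gd)) ?expg_a2_gd // => {}w.
  by rewrite expgS !mul_tautE !grigE.
rewrite (section_expg (g := gd * a2)) ?expg_gd_a2 // => {}w.
by rewrite expgS !mul_tautE !grigE.
Qed.

Lemma gb_a2_commgE : [~ gb, a2] = gb * (a2 * (gb * a2)).
Proof. by rewrite commgEl conjgE gbV a2V. Qed.

Lemma expg_gb_a2_commg : [~ gb, a2] ^+ 8 = 1.
Proof.
apply: treeAut_cons_ext; elim/ord2P => w.
  rewrite (section_expg (g := a2 * gc)) ?expg_a2_gc // => {}w.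
  by rewrite gb_a2_commgE !mul_tautE !grigE.
rewrite (section_expg (g := gc * a2)) ?expg_gc_a2 // => {}w.
by rewrite gb_a2_commgE !mul_tautE !grigE.
Qed.

Lemma gb_a2_commg_neq1 : [~ gb, a2] <> 1.
Proof.
move=> /(congr1 (fun g : treeAut 2 => g [:: 0; 0]%R)).
by rewrite gb_a2_commgE !mul_tautE !grigE.
Qed.

(** * The normal closure of [b, a] and its copies below a letter *)

Definition GrigN : set (treeAut 2) :=
  generated [set y | exists2 g, Grig g & y = [~ gb, a2] ^ g].

Lemma GrigN_subgroup : subgroup GrigN.
Proof. exact: generated_subgroup. Qed.

Lemma Grig_subgroup : subgroup Grig.
Proof. exact: generated_subgroup. Qed.

Lemma Grig_gens : [/\ Grig a2, Grig gb, Grig gc & Grig gd].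
Proof. by split; apply: sub_gen_smallest; rewrite /= ; tauto. Qed.

Lemma GrigN_normal g x : Grig g -> GrigN x -> GrigN (x ^ g).
Proof.
have [_ GM _] := Grig_subgroup.
move=> Gg; apply: conj_generated => _ [h Gh ->]; rewrite -conjgM.
by apply: sub_gen_smallest; exists (h * g) => //; exact: GM.
Qed.

Lemma GrigN_commg : GrigN [~ gb, a2].
Proof.
have [G1 _ _] := Grig_subgroup.
by apply: sub_gen_smallest; exists 1; rewrite ?conjg1.
Qed.

Lemma GrigN_sub : GrigN `<=` Grig.
Proof.
have [Ga Gb _ _] := Grig_gens; have GG := Grig_subgroup.
apply: generated_sub => // _ [g Gg ->]; apply: (@subgroup_conjg _ Grig) => //.
exact: (@subgroup_commg _ Grig).
Qed.

(** Below the letter 1 the elements a b a, d, b, c act as a, b, c, d, so [branch_lift] leaves only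
    the case x = [b, a]. *)
Lemma GrigN_branch x : GrigN x -> GrigN (branch 1%R x).
Proof.
have [Ga Gb Gc Gd] := Grig_gens; have [_ GM _] := Grig_subgroup.
have [_ NM NV] := GrigN_subgroup.
have [|subM normM] := branch_lift (A := [set a2; gb; gc; gd]) (i := 1%R)
    GrigN_subgroup GrigN_normal.
  move=> g [[[->|->]|->]|->].
  - exists (a2 * (gb * a2)); first by apply: (GM) => //; exact: GM.
    by move=> w; rewrite !mul_tautE !grigE.
  - by exists gd => // w; rewrite grigE.
  - by exists gb => // w; rewrite grigE.
  - by exists gc => // w; rewrite grigE.
apply: (generated_sub subM) => _ [g Gg ->] /=; apply: normM => //.
(* psi(d) = (1, b) and psi(aba) = (c, a). *)
have -> : branch 1%R [~ gb, a2] = [~ gd, a2 * (gb * a2)].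
  rewrite gb_a2_commgE commgEl conjgE !invgM a2V gbV gdV.
  apply: treeAut_cons_ext => k w.
  elim/ord2P: k; rewrite ?branch_self ?branch_other // !mul_tautE !grigE //.
  by rewrite one_tautE gcK.
(* Since d commutes with b, replacing a b a by b [b, a] turns the commutator into a product of a
   conjugate of [b, a]^-1 with [b, a]. *)
have -> : a2 * (gb * a2) = gb * [~ gb, a2].
  by apply: treeAut_ext => w; rewrite gb_a2_commgE !mul_tautE gbK.
have comm_db : commute gd gb.
  by apply: treeAut_ext => w; rewrite !mul_tautE; case: (gbcd_commute w).
suff -> : [~ gd, gb * [~ gb, a2]] = [~ gb, a2]^-1 ^ gd * [~ gb, a2].
  apply: NM; last exact: GrigN_commg.
  by apply: GrigN_normal => //; apply: NV; exact: GrigN_commg.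
rewrite commgEr (invgM gb) (conjMg [~ gb, a2]^-1 gb^-1) -mulgA; congr (_ * _).
have -> : gb^-1 ^ gd = gb^-1 by rewrite conjgE gbV -comm_db mulKg.
by rewrite mulKg.
Qed.

(** The infinite family of torsion elements lies in every G containing Grigorchuk's group, so the
    overgroup is covered too. *)
Lemma Grig_no_torsion_free (G : set (treeAut 2)) : Grig `<=` G ->
  ~ (exists H, [/\ subgroup H, H `<=` G, finite_set (lcosets G H) & torsion_free H]).
Proof.
move=> GG; apply: (@no_torsion_free _ G GrigN 1%R 0%R [~ gb, a2] 8) => //.
- exact: subset_trans GrigN_sub GG.
- exact: GrigN_branch.
- rewrite branch_root_cycle; have [Ga _ _ _] := Grig_gens.
  apply: GrigN_normal => //; rewrite (_ : ordS _ = 1%R); last exact: val_inj.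
  by apply: GrigN_branch; exact: GrigN_commg.
- exact: expg_gb_a2_commg.
- exact: gb_a2_commg_neq1.
Qed.

Lemma gbcd_tbcd : [/\ gb = td * tb, gc = tb * tc & gd = tc * td].
Proof.
suff E w : [/\ gb w = td (tb w), gc w = tb (tc w) & gd w = tc (td w)].
  by split; apply: treeAut_ext => w; rewrite mul_tautE; case: (E w).
elim: w => [|k w [IHb IHc IHd]]; first by rewrite !taut_nil.
by elim/ord2P: k; rewrite !grigE !tgrigE ?IHb ?IHc ?IHd.
Qed.

Lemma Grig_sub_TGrig : Grig `<=` TGrig.
Proof.
have HT : subgroup TGrig := generated_subgroup _.
have [T1 TM TV] := HT.
have [Ta Tb Tc Td] : [/\ TGrig a2, TGrig tb, TGrig tc & TGrig td].
  by split; apply: sub_gen_smallest; rewrite /=; tauto.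
have [gbE gcE gdE] := gbcd_tbcd.
apply: generated_sub => // g [[[->|->]|->]|->] //; rewrite ?gbE ?gcE ?gdE;
  exact: TM.
Qed.

End Grigorchuk.

(** * The Gupta-Sidki group *)

Section GuptaSidki.

Lemma a3_0 w : a3 (0%R :: w) = 1%R :: w.
Proof. by congr (_ :: _); apply: val_inj. Qed.
Lemma a3_1 w : a3 (1%R :: w) = (1 + 1)%R :: w.
Proof. by congr (_ :: _); apply: val_inj. Qed.
Lemma a3_2 w : a3 ((1 + 1)%R :: w) = 0%R :: w.
Proof. by congr (_ :: _); apply: val_inj. Qed.
Lemma a3V_1 w : a3^-1 (1%R :: w) = 0%R :: w.
Proof. by rewrite -a3_0 taut_invK. Qed.
Lemma a3V_2 w : a3^-1 ((1 + 1)%R :: w) = 1%R :: w.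
Proof. by rewrite -a3_1 taut_invK. Qed.
Lemma a3V_0 w : a3^-1 (0%R :: w) = (1 + 1)%R :: w.
Proof. by rewrite -a3_2 taut_invK. Qed.
Lemma t3_0 w : t3 (0%R :: w) = 0%R :: a3 w. Proof. exact: psi_t3. Qed.
Lemma t3_1 w : t3 (1%R :: w) = 1%R :: a3^-1 w. Proof. exact: psi_t3. Qed.
Lemma t3_2 w : t3 ((1 + 1)%R :: w) = (1 + 1)%R :: t3 w. Proof. exact: psi_t3. Qed.
Lemma t3V_0 w : t3^-1 (0%R :: w) = 0%R :: a3^-1 w.
Proof. by apply: (bij_inj (taut_bij t3)); rewrite t3_0 !taut_Kinv. Qed.
Lemma t3V_1 w : t3^-1 (1%R :: w) = 1%R :: a3 w.
Proof. by apply: (bij_inj (taut_bij t3)); rewrite t3_1 taut_Kinv taut_invK. Qed.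
Lemma t3V_2 w : t3^-1 ((1 + 1)%R :: w) = (1 + 1)%R :: t3^-1 w.
Proof. by apply: (bij_inj (taut_bij t3)); rewrite t3_2 !taut_Kinv. Qed.

Let gsE := (a3_0, a3_1, a3_2, a3V_0, a3V_1, a3V_2, t3_0, t3_1, t3_2,
  t3V_0, t3V_1, t3V_2).
Let gsK := (@taut_invK 3 a3, @taut_Kinv 3 a3, @taut_invK 3 t3, @taut_Kinv 3 t3).

Lemma t3_cube : t3 ^+ 3 = 1.
Proof.
by apply: cube_psi psi_t3; rewrite ?expVgn a3_cube ?invg1.
Qed.

(** The cube of a t fixes the letters and acts below each of them as a conjugate of t, whose cube is
    1. *)
Lemma expg_a3_t3 : (a3 * t3) ^+ 9 = 1.
Proof.
rewrite (expgnA _ 3 3); apply: treeAut_cons_ext; elim/ord3P => w.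
- rewrite (section_expg (g := t3)) ?t3_cube // => {}w.
  by rewrite !expgS expg0 !mul_tautE !gsE !gsK.
- rewrite (section_expg (g := t3 ^ a3^-1)) -?conjXg ?t3_cube ?conj1g // => {}w.
  by rewrite conjgE invgK !expgS expg0 !mul_tautE !gsE ?gsK.
- rewrite (section_expg (g := t3)) ?t3_cube // => {}w.
  by rewrite !expgS expg0 !mul_tautE !gsE !gsK.
Qed.

Lemma expg_t3V_a3 : (t3^-1 * a3) ^+ 9 = 1.
Proof.
have tV3 : t3^-1 ^+ 3 = 1 by rewrite expVgn t3_cube invg1.
rewrite (expgnA _ 3 3); apply: treeAut_cons_ext; elim/ord3P => w.
- rewrite (section_expg (g := t3^-1 ^ a3)) -?conjXg ?tV3 ?conj1g // => {}w.
  by rewrite conjgE !expgS expg0 !mul_tautE !gsE ?gsK.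
- rewrite (section_expg (g := t3^-1)) ?tV3 // => {}w.
  by rewrite !expgS expg0 !mul_tautE !gsE !gsK.
- rewrite (section_expg (g := t3^-1)) ?tV3 // => {}w.
  by rewrite !expgS expg0 !mul_tautE !gsE !gsK.
Qed.

(** Below the letters 0, 1, 2 the commutator acts as a^-2, a t and t^-1 a. *)
Lemma expg_t3_a3_commg : [~ t3, a3] ^+ 9 = 1.
Proof.
rewrite commgEl conjgE; apply: treeAut_cons_ext; elim/ord3P => w.
- rewrite (section_expg (g := a3^-1 * a3^-1)) => [|{}w].
    by rewrite -expg2 -expgnA (expgnA _ 3 6) expVgn a3_cube invg1 expg1n.
  by rewrite !mul_tautE !gsE.
- rewrite (section_expg (g := a3 * t3)) ?expg_a3_t3 // => {}w.
  by rewrite !mul_tautE !gsE.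
- rewrite (section_expg (g := t3^-1 * a3)) ?expg_t3V_a3 // => {}w.
  by rewrite !mul_tautE !gsE.
Qed.

Lemma t3_a3_commg_neq1 : [~ t3, a3] <> 1.
Proof.
move=> /(congr1 (fun g : treeAut 3 => g [:: 0; 0]%R)).
by rewrite commgEl conjgE !mul_tautE !gsE.
Qed.

Definition GBBder : set (treeAut 3) :=
  generated [set y | exists g h, [/\ GammaBarBar g, GammaBarBar h & y = [~ g, h]]].

Lemma GBBder_subgroup : subgroup GBBder.
Proof. exact: generated_subgroup. Qed.

Lemma GBB_subgroup : subgroup GammaBarBar.
Proof. exact: generated_subgroup. Qed.

Lemma GBB_gens : GammaBarBar a3 /\ GammaBarBar t3.
Proof. by split; apply: sub_gen_smallest; rewrite /=; tauto. Qed.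

Lemma GBB_conjg x g : GammaBarBar x -> GammaBarBar g -> GammaBarBar (x ^ g).
Proof. exact: (@subgroup_conjg _ GammaBarBar _ _ GBB_subgroup). Qed.

Lemma GBBder_commg x y : GammaBarBar x -> GammaBarBar y -> GBBder [~ x, y].
Proof. by move=> Gx Gy; apply: sub_gen_smallest; exists x, y. Qed.

Lemma GBBder_normal g x : GammaBarBar g -> GBBder x -> GBBder (x ^ g).
Proof.
move=> Gg; apply: conj_generated => _ [h [k [Gh Gk ->]]]; rewrite conjRg.
by apply: GBBder_commg; exact: GBB_conjg.
Qed.

Lemma GBBder_sub : GBBder `<=` GammaBarBar.
Proof.
have GG := GBB_subgroup.
apply: generated_sub => // _ [g [h [Gg Gh ->]]].
exact: (@subgroup_commg _ GammaBarBar).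
Qed.

(** Below the letter 2 the elements t^a and t act as a and t, so [branch_lift] applies; then
    [generated_commutators] leaves only x = [t, a]. *)
Lemma GBBder_branch x : GBBder x -> GBBder (branch (1 + 1)%R x).
Proof.
have [Ga Gt] := GBB_gens; have [G1 GM GV] := GBB_subgroup.
have [|subM normM] := branch_lift (A := [set a3; t3]) (i := (1 + 1)%R)
    GBBder_subgroup GBBder_normal.
  move=> g [->|->].
  - exists (t3 ^ a3); first exact: GBB_conjg.
    by move=> w; rewrite conjgE !mul_tautE !gsE.
  - by exists t3 => // w; rewrite gsE.
have [M1 MM MV] := subM.
have Mta : GBBder (branch (1 + 1)%R [~ t3, a3]).
  (* By a^3 = 1, the right-hand side t^-1 a^2 t a^-2 equals [t, a]. The pair a t, a^-1 t is chosen
     because both are last components of group elements whose other components commute. *)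
  have -> : [~ t3, a3] = [~ a3 * t3, a3^-1 * t3] ^ (a3 * t3)^-1.
    have a3a3 w : a3 (a3 w) = a3^-1 w.
      by rewrite -[RHS]one_tautE -a3_cube expg3E taut_Kinv.
    rewrite !commgEl !conjgE !invgM !invgK; apply: treeAut_ext => w.
    by rewrite !mul_tautE !gsK a3a3 -(a3a3 w) !gsK.
  apply: normM; first by apply: (GV); exact: GM.
  (* psi(t^a t) = (1, t a^-1, a t) and psi(t^(a^-1) t) = (t a, 1, a^-1 t) commute
     except in the last component. *)
  have -> : branch (1 + 1)%R [~ a3 * t3, a3^-1 * t3] =
      [~ t3 ^ a3 * t3, t3 ^ a3^-1 * t3].
    rewrite !commgEl !conjgE !invgM !invgK.
    apply: treeAut_cons_ext => k w.
    by elim/ord3P: k; rewrite ?branch_self ?branch_other // !mul_tautE !gsE ?gsK.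
  by apply: GBBder_commg; apply: (GM) => //; apply: GBB_conjg => //; exact: GV.
apply: (generated_sub subM) => _ [g [h [Gg Gh ->]]].
apply: (generated_commutators subM normM) Gg Gh => x' y' [->|->] [->|->] /=;
  rewrite ?commgg ?branch1 //.
- by case: GBBder_subgroup.
- by rewrite -invgR; exact: MV.
- by case: GBBder_subgroup.
Qed.

Lemma GBB_no_torsion_free : ~ (exists H, [/\ subgroup H, H `<=` GammaBarBar,
  finite_set (lcosets GammaBarBar H) & torsion_free H]).
Proof.
have [Ga Gt] := GBB_gens.
apply: (@no_torsion_free _ _ GBBder (1 + 1)%R 1%R [~ t3, a3] 9) => //.
- exact: GBBder_sub.
- exact: GBBder_branch.
- rewrite branch_root_cycle; apply: GBBder_normal => //.
  rewrite (_ : ordS _ = (1 + 1)%R); last exact: val_inj.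
  by apply: GBBder_branch; exact: GBBder_commg.
- exact: expg_t3_a3_commg.
- exact: t3_a3_commg_neq1.
Qed.

End GuptaSidki.

(** * The index of K and KBar, and the three statements *)

Lemma a3_neq1 : a3 <> 1.
Proof. by move=> /(congr1 (fun g : treeAut 3 => g [:: 0%R])). Qed.

(** Being torsion-free, K does not contain a, which has order 3; this separates the cosets. *)
Lemma lcosets_Gamma_K : K `<=` Gamma /\ lcosets Gamma K #= `I_3.
Proof.
have HG : subgroup Gamma := generated_subgroup _; have [_ GM GV] := HG.
have Ga : Gamma a3 by apply: sub_gen_smallest; left.
have Gr : Gamma r3 by apply: sub_gen_smallest; right.
split; first by apply: generated_sub => // _ [->|->]; exact: GM.
apply: (lcosets_card3 (generated_subgroup _) a3_cube) => //.
- by move=> /K_torsion_free/(_ (isT : 0 < 3)%N a3_cube)/a3_neq1.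
- exact: K_normal.
move=> _ [->|->].
  by exists 2; rewrite -expgSr a3_cube; case: (generated_subgroup [set a3 * r3; r3 * a3]).
by exists 1%N; rewrite expg1; apply: sub_gen_smallest; left.
Qed.

Lemma lcosets_GammaBar_KBar : KBar `<=` GammaBar /\ lcosets GammaBar KBar #= `I_3.
Proof.
have HG : subgroup GammaBar := generated_subgroup _; have [_ GM GV] := HG.
have Ga : GammaBar a3 by apply: sub_gen_smallest; left.
have Gs : GammaBar s3 by apply: sub_gen_smallest; right.
have a3V : a3^-1 = a3 ^+ 2 by apply: (mulgI a3); rewrite mulgV -expgS a3_cube.
split.
  by apply: generated_sub => // _ [->|->]; apply: GM => //; exact: GV.
apply: (lcosets_card3 (generated_subgroup _) a3_cube) => //.
- by move=> /KBar_torsion_free/(_ (isT : 0 < 3)%N a3_cube)/a3_neq1.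
- exact: KBar_normal.
(* The exponent 2 serves both generators: a^2 a = 1 and a^2 s = a^-1 s. *)
move=> _ [->|->]; exists 2.
  by rewrite -expgSr a3_cube; case: (generated_subgroup [set s3 * a3^-1; a3^-1 * s3]).
by rewrite -a3V; apply: sub_gen_smallest; right.
Qed.

Theorem mainTheorem7 :
  [/\ (* (a) *)
      (exists H : set (treeAut 3),
         [/\ subgroup H, H `<=` Gamma, lcosets Gamma H #= `I_3
           & torsion_free H])
      /\ (exists H : set (treeAut 3),
         [/\ subgroup H, H `<=` GammaBar, lcosets GammaBar H #= `I_3
           & torsion_free H]),
      (* (b) *)
      torsion_free K /\ torsion_free KBar
    & (* (c) *)
      [/\ ~ (exists H : set (treeAut 2),
             [/\ subgroup H, H `<=` Grig, finite_set (lcosets Grig H)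
               & torsion_free H]),
          ~ (exists H : set (treeAut 2),
             [/\ subgroup H, H `<=` TGrig, finite_set (lcosets TGrig H)
               & torsion_free H])
        & ~ (exists H : set (treeAut 3),
             [/\ subgroup H, H `<=` GammaBarBar,
                 finite_set (lcosets GammaBarBar H) & torsion_free H])]].
Proof.
split; last split.
- split.
    exists K; have [KG cK] := lcosets_Gamma_K.
    by split=> //; [exact: generated_subgroup|exact: K_torsion_free].
  exists KBar; have [KG cK] := lcosets_GammaBar_KBar.
  by split=> //; [exact: generated_subgroup|exact: KBar_torsion_free].
- by split; [exact: K_torsion_free|exact: KBar_torsion_free].
- exact: Grig_no_torsion_free.
- exact: Grig_no_torsion_free Grig_sub_TGrig.
- exact: GBB_no_torsion_free.
Qed.
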